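(* Let $G$ be an amenable finitely generated (discrete) group, and let $\mu$ be a courteous probability measure on $G$. Let $f:G\to\mathbb R$ be a function that converges along random walks. If $\dim\,\mathrm{span}(G.f)<\infty$, then $f$ is constant.
   Context: Let $G$ be a finitely generated group with a fixed finite symmetric generating set, and let $|x|$ be the corresponding word length. A probability measure $\mu$ on $G$ is courteous if it is adapted (there is no proper subgroup $H\lneq G$ with $\mu(H)=1$), symmetric ($\mu(x)=\mu(x^{-1})$ for all $x\in G$), and has a third moment ($\sum_{s\in G} |s|^3\mu(s)<\infty$). The $\mu$-random walk is $X_0=1$, $X_t=U_1\cdots U_t$, with $(U_t)_{t\ge1}$ i.i.d. of law $\mu$. A function $f:G\to\mathbb R$ converges along random walks if for every $x\in G$ the sequence $(f(xX_t))_t$ converges almost surely. $G$ acts on functions $f:G\to\mathbb R$ by $(\gamma.f)(x)=f(\gamma^{-1}x)$; $G.f=\{\gamma.f:\gamma\in G\}$ is the orbit of $f$, and $\mathrm{span}(G.f)$ is its real linear span. *)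

(* Defs.v *)
From HB Require Import structures.
From mathcomp Require Import all_boot all_order all_algebra finmap.
From mathcomp Require Import all_classical all_reals all_analysis.

Set Implicit Arguments.
Unset Strict Implicit.
Unset Printing Implicit Defensive.

Import Order.TTheory GRing.Theory Num.Theory.
Import numFieldNormedType.Exports.

Local Open Scope classical_set_scope.
Local Open Scope ring_scope.

(* A group with its power set as sigma-algebra, so that a probability measure
   on the discrete group G is a [probability (discrete G) R]. *)
Definition discrete (G : groupType) : Type := G.

HB.instance Definition _ (G : groupType) := Group.on (discrete G).
HB.instance Definition _ (G : groupType) :=
  isPointed.Build (discrete G) (1%g : G).
HB.instance Definition _ (G : groupType) :=
  @isMeasurable.Build default_measure_display (discrete G)
    discrete_measurable discrete_measurable0
    discrete_measurableC discrete_measurableU.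

Definition symmetric_set (G : groupType) (S : {fset G}) : Prop :=
  forall s, s \in S -> s^-1%g \in S.

Definition generates (G : groupType) (S : {fset G}) : Prop :=
  forall H : set G, group_closed [in H] -> [set` S] `<=` H -> H = [set: G].

Definition spelled (G : groupType) (S : {fset G}) (x : G) (n : nat) : Prop :=
  exists w : seq G,
    [/\ size w = n, {subset w <= S} & (\big[*%g/1%g]_(s <- w) s)%g = x].

(* The junk value 0 only occurs when S does not generate G as a monoid. *)
Definition word_length (G : groupType) (S : {fset G}) (x : G) : nat :=
  if pselect (exists n, `[< spelled S x n >]) is left h then ex_minn h else 0%N.

(* Foelner's condition, for left translations. *)
Definition amenable (R : realType) (G : groupType) : Prop :=
  forall (K : {fset G}) (e : R), 0 < e ->
    exists2 F : {fset G}, F != fset0 &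
      forall g, g \in K ->
        let gF := [fset (g * x)%g | x in F]%fset in
        (#|` (gF `\` F) `|` (F `\` gF)|%fset)%:R <= e * (#|` F|)%:R.

Section courteous.
Context (R : realType) (G : groupType).
Implicit Type mu : probability (discrete G) R.

Definition adapted mu : Prop :=
  forall H : set G, group_closed [in H] -> mu H = 1%E -> H = [set: G].

Definition symmetric_measure mu : Prop :=
  forall x : G, mu [set x] = mu [set x^-1%g].

Definition third_moment (S : {fset G}) mu : Prop :=
  (\esum_(s in [set: G]) (((word_length S s)%:R ^+ 3)%:E * mu [set s])
     < +oo)%E.

Definition courteous (S : {fset G}) mu : Prop :=
  [/\ adapted mu, symmetric_measure mu & third_moment S mu].

End courteous.

Definition mutually_independent (R : realType) (d d' : measure_display)
    (Omega : measurableType d) (T : measurableType d')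
    (P : probability Omega R) (U : nat -> {RV P >-> T}) : Prop :=
  forall (J : {fset nat}) (A : nat -> set T),
    (forall j, j \in J -> measurable (A j)) ->
    P (\bigcap_(j in [set` J]) (U j @^-1` A j)) =
      (\prod_(j <- J) P (U j @^-1` A j))%E.

Definition iid (R : realType) (d d' : measure_display)
    (Omega : measurableType d) (T : measurableType d')
    (P : probability Omega R) (mu : probability T R)
    (U : nat -> {RV P >-> T}) : Prop :=
  mutually_independent U /\
  (forall t (A : set T), measurable A -> distribution P (U t) A = mu A).

Section random_walk.
Context (R : realType) (G : groupType) (d : measure_display).
Context (Omega : measurableType d) (P : probability Omega R).

(* The increments are indexed from 0: the t-th step is [U t.-1]. *)
Definition walk (U : nat -> {RV P >-> discrete G}) (t : nat) (w : Omega) : G :=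
  (\big[*%g/1%g]_(i < t) (U i w : G))%g.

Definition converges_along_walks (U : nat -> {RV P >-> discrete G})
    (f : G -> R) : Prop :=
  forall x : G, {ae P, forall w, cvgn (fun t => f (x * walk U t w)%g)}.

End random_walk.

Section span.
Context (R : realType) (V : lmodType R).

Definition lin_span (A : set V) : set V :=
  [set v | exists n (a : 'I_n -> R) (u : 'I_n -> V),
     (forall i, A (u i)) /\ v = \sum_(i < n) a i *: u i].

Definition finite_dimensional (W : set V) : Prop :=
  exists n (b : 'I_n -> V), W = lin_span (range b).

End span.

Definition translate (R : realType) (G : groupType) (g : G) (f : G -> R) :
  G -> R^o := fun x => f (g^-1 * x)%g.

Definition fun_orbit (R : realType) (G : groupType) (f : G -> R) :
  set (G -> R^o) :=
  [set translate g f | g in [set: G]].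

(* Main.v *)
(** Convergence of [f] along the walk makes [f (x X_(t+1)) - f (x X_t)] tend
    to 0 in probability; conditioning on the independent step [U_t = s], for
    the atoms [s] of the adapted measure [mu], gives
    [f (x X_t g) - f (x X_t) -> 0] in probability for all [x] and [g]. As [mu]
    is symmetric, [X_t] can be replaced by its inverse. The kernel
    [K x y = f (x y) - f x] has finite rank, hence [K x y] is a sum of terms
    [u_i x * v_i y] where [u_i] and [v_i] are combinations of columns and rows
    of [K]. Evaluating [K x y] as
    [f (x X_t X_t^-1 y) - f (x X_t X_t^-1)], i.e. as the sum of the
    [u_i (x X_t) * (v_i (X_t^-1 y) - v_i (X_t^-1))], shows that this constant
    tends to 0 in probability, so that it vanishes. *)

Require Import Defs.
From mathcomp Require Import all_boot all_order all_algebra finmap.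
From mathcomp Require Import all_classical all_reals all_analysis.
From mathcomp Require Import measurable_realfun ring lra.

Set Implicit Arguments.
Unset Strict Implicit.
Unset Printing Implicit Defensive.

Import Order.TTheory GRing.Theory Num.Theory.
Import numFieldNormedType.Exports.

Local Open Scope classical_set_scope.
Local Open Scope ring_scope.

(** * Finite-rank kernels *)

Section finite_rank_kernels.
Context (R : fieldType) (X Y : Type).

(** Induction on [n]: subtracting a multiple of (column of [K]) times (row of [K]) leaves a kernel
    with one term less, whose columns and rows still lie in [A] and [B]. A zero kernel is the empty
    sum. *)
Lemma finite_rank_kernel_decomposition (A : set (X -> R)) (B : set (Y -> R))
    (A_lin : forall (c : R) u v, A u -> A v -> A (fun x => c * u x + v x))
    (B_lin : forall (c : R) u v, B u -> B v -> B (fun y => c * u y + v y))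
    (n : nat) (K : X -> Y -> R) (a : 'I_n -> X -> R) (b : 'I_n -> Y -> R) :
  (forall y, A (K^~ y)) -> (forall x, B (K x)) ->
  (forall x y, K x y = \sum_i a i x * b i y) ->
  exists m (u : 'I_m -> X -> R) (v : 'I_m -> Y -> R),
    [/\ forall i, A (u i), forall i, B (v i)
      & forall x y, K x y = \sum_i u i x * v i y].
Proof.
elim: n K a b => [|n IHn] K a b AK BK KE.
  exists 0%N, (fun=> fun=> 0), (fun=> fun=> 0); split=> [[]//|[]//|x y].
  by rewrite KE !big_ord0.
have [[[x1 y1] p0]|K0] := pselect (exists p, K p.1 p.2 != 0); last first.
  exists 0%N, (fun=> fun=> 0), (fun=> fun=> 0); split=> [[]//|[]//|x y].
  rewrite big_ord0; apply/eqP/negP => /negP Kxy.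
  by apply: K0; exists (x, y).
rewrite /= in p0; set p := K x1 y1 in p0.
have [k bk] : exists k, b k y1 != 0.
  apply: contrapT => b0; move/eqP: p0; apply.
  rewrite /p KE big1// => i _; apply/eqP; rewrite mulf_eq0; apply/orP; right.
  by apply/negP => /negP bi; apply: b0; exists i.
(* Gaussian elimination with pivot [K x1 y1] lowers the rank by one. *)
pose K1 x y := - (K x y1 / p) * K x1 y + K x y.
pose a1 i x := a i x - K x y1 * a i x1 / p.
have K1E x y : K1 x y = \sum_i a1 i x * b i y.
  rewrite /K1 !KE /a1 mulr_sumr -big_split/=; apply: eq_bigr => i _.
  by rewrite -KE; ring.
have a1y x : \sum_i a1 i x * b i y1 = 0.
  by rewrite -K1E /K1 -/p mulNr divfK// addNr.
have [||x y|m [u [v [Au Bv uvE]]]] := IHn K1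
    (fun i => a1 (lift k i))
    (fun i y => b (lift k i) y - b (lift k i) y1 / b k y1 * b k y).
- move=> y; have := A_lin (- (K x1 y / p)) _ _ (AK y1) (AK y).
  by congr A; apply/funext => x; rewrite /K1; ring.
- by move=> x; exact: B_lin.
- rewrite K1E (bigD1_ord k)//=.
  have /eqP := a1y x; rewrite (bigD1_ord k)//= addr_eq0 => /eqP a1k.
  have -> : a1 k x = - (\sum_(i < n) a1 (lift k i) x * b (lift k i) y1) / b k y1.
    by rewrite -a1k mulfK.
  rewrite mulNr mulNr mulr_suml mulr_suml -sumrN -big_split/=.
  by apply: eq_bigr => i _; ring.
exists m.+1, (fun i => oapp u (K^~ y1) (unlift ord0 i)).
(* The added right factor is [K x1 y / p], written in the form that [B_lin] accepts. *)
exists (fun i => oapp v (fun y => (p^-1 - 1) * K x1 y + K x1 y)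
                        (unlift ord0 i)); split=> [i|i|x y].
- by case: unliftP => [j|] _ /=.
- by case: unliftP => [j|] _ /=; [exact: Bv|exact: B_lin].
rewrite big_ord_recl unlift_none/=.
under eq_bigr do rewrite liftK/=.
by rewrite -uvE /K1; ring.
Qed.

End finite_rank_kernels.

(** * Convergence to 0 in probability *)

Section convergence_to_zero_in_probability.
Context (R : realType) (d : measure_display) (Omega : measurableType d).
Context (P : probability Omega R).
Implicit Types Y Z : nat -> Omega -> R.
Local Open Scope ereal_scope.

Definition cvg0_in_probability Y :=
  (forall n, measurable_fun setT (Y n)) /\
  forall e : R, (0 < e)%R ->
    P [set w | e <= `|Y n w|]%R @[n --> \oo] --> 0.

Lemma measurable_norm_ge (e : R) (g : Omega -> R) :
  measurable_fun setT g -> measurable [set w | e <= `|g w|]%R.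
Proof.
move=> mg; rewrite -[X in measurable X]setTI.
have -> : [set w | (e <= `|g w|)%R] = (Num.norm \o g) @^-1` `[e, +oo[.
  by apply/seteqP; split => w /=; rewrite in_itv/= andbT.
by apply: measurableT_comp => //; exact: measurableT_comp.
Qed.

(** Union bound and squeezing. It serves the closure properties below, where a large value of a
    combination forces a large value of one of its two terms. *)
Lemma subset_setU_cvg0 (A B C : nat -> set Omega) :
  (forall n, measurable (A n)) -> (forall n, measurable (B n)) ->
  (forall n, measurable (C n)) -> (forall n, A n `<=` B n `|` C n) ->
  P (B n) @[n --> \oo] --> 0 -> P (C n) @[n --> \oo] --> 0 ->
  P (A n) @[n --> \oo] --> 0.
Proof.
move=> mA mB mC ABC B0 C0.
apply: (@squeeze_cvge _ _ _ _ (cst 0) _ (fun n => P (B n) + P (C n))).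
- apply: nearW => n; rewrite measure_ge0/=.
  apply: (le_trans _ (measureU2 _ _ _)) => //.
  by rewrite le_measure// inE//; exact: measurableU.
- exact: cvg_cst.
- by rewrite -[X in _ --> X]adde0; exact: cvgeD.
Qed.

Lemma subset_cvg0 (A B : nat -> set Omega) :
  (forall n, measurable (A n)) -> (forall n, measurable (B n)) ->
  (forall n, A n `<=` B n) ->
  P (B n) @[n --> \oo] --> 0 -> P (A n) @[n --> \oo] --> 0.
Proof.
by move=> mA mB AB B0; apply: (subset_setU_cvg0 mA mB mB) => // n w /AB; left.
Qed.

Lemma cvg0_in_probability_cst (c : R) :
  cvg0_in_probability (fun=> cst c) -> c = 0%R.
Proof.
move=> [_ c0]; apply/eqP; apply: contrapT => /negP; rewrite -normr_gt0 => {}/c0.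
have -> : [set w | `|c| <= `|cst c w|]%R = [set: Omega].
  by apply/seteqP; split => // w _ /=; exact: lexx.
rewrite probability_setT => c0.
have /eqP : 0 = 1 :> \bar R.
  by apply: (cvg_unique (@ereal_hausdorff R) c0); exact: cvg_cst.
by rewrite eqe eq_sym oner_eq0.
Qed.

Lemma cvg0_in_probability_lin (c : R) Y Z :
  cvg0_in_probability Y -> cvg0_in_probability Z ->
  cvg0_in_probability (fun n w => c * Y n w + Z n w)%R.
Proof.
move=> [mY Y0] [mZ Z0].
have mYZ n : measurable_fun setT (fun w => c * Y n w + Z n w)%R.
  by apply: measurable_funD => //; exact: measurable_funM.
split=> // e e0.
(* Adding 1 to the absolute value of [c] keeps the threshold for [Y] meaningful when [c = 0]. *)
have c1 : (0 < `|c| + 1)%R by rewrite ltr_wpDl.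
have e2 : (0 < e / 2)%R by rewrite divr_gt0.
have ec : (0 < e / 2 / (`|c| + 1))%R by rewrite divr_gt0.
apply: (subset_setU_cvg0 _ _ _ _ (Y0 _ ec) (Z0 _ e2)) => n.
- exact: measurable_norm_ge.
- exact: measurable_norm_ge.
- exact: measurable_norm_ge.
move=> w /= eYZ; have [|Yw] := leP (e / 2 / (`|c| + 1))%R `|Y n w|%R.
  by left.
right.
have : (`|c * Y n w| <= e / 2)%R.
  rewrite normrM; rewrite ltr_pdivlMr// in Yw.
  apply: le_trans (ltW Yw); rewrite mulrC ler_wpM2l// lerDl//.
have := ler_normD (c * Y n w)%R (Z n w); lra.
Qed.

Lemma cvg0_in_probability0 : cvg0_in_probability (fun=> cst 0%R).
Proof.
split=> [n|e e0]; first exact: measurable_cst.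
have -> : [set w | e <= `|cst 0%R w : R|]%R = set0 :> set Omega.
  by apply/seteqP; split => // w /=; rewrite normr0 leNgt e0.
by rewrite measure0; exact: cvg_cst.
Qed.

Lemma cvg0_in_probabilityM Y Z :
  cvg0_in_probability Y -> cvg0_in_probability Z ->
  cvg0_in_probability (fun n w => Y n w * Z n w)%R.
Proof.
move=> [mY Y0] [mZ Z0].
have mYZ n : measurable_fun setT (fun w => Y n w * Z n w)%R.
  exact: measurable_funM.
split=> // e e0.
apply: (subset_setU_cvg0 _ _ _ _ (Y0 _ ltr01) (Z0 _ e0)) => n.
- exact: measurable_norm_ge.
- exact: measurable_norm_ge.
- exact: measurable_norm_ge.
move=> w /= eYZ; have [|Yw] := leP 1%R `|Y n w|%R; [by left|right].
by apply: (le_trans eYZ); rewrite normrM ler_piMl// ltW.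
Qed.

Lemma cvg0_in_probability_sum (m : nat) (Y : 'I_m -> nat -> Omega -> R) :
  (forall i, cvg0_in_probability (Y i)) ->
  cvg0_in_probability (fun n w => \sum_i Y i n w)%R.
Proof.
elim: m Y => [Y _|m IHm Y Y0].
  by under eq_fun do under eq_fun do rewrite big_ord0; exact: cvg0_in_probability0.
under eq_fun do under eq_fun do
  rewrite big_ord_recl -[Y ord0 _ _](mul1r).
by apply: cvg0_in_probability_lin => //; exact: IHm.
Qed.

(** Continuity from above: the events [B n] that some increment from time [n] on is at least [e]
    decrease to a null set. *)
Lemma ae_cvg_increments Y : (forall n, measurable_fun setT (Y n)) ->
  {ae P, forall w, cvgn (Y^~ w)} ->
  cvg0_in_probability (fun n w => Y n.+1 w - Y n w)%R.
Proof.
move=> mY [N [mN N0 YN]].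
have mD n : measurable_fun setT (fun w => Y n.+1 w - Y n w)%R.
  exact: measurable_funB.
split=> // e e0.
pose A n := [set w | e <= `|Y n.+1 w - Y n w|]%R.
have mA n : measurable (A n) by exact: measurable_norm_ge.
pose B n := \bigcup_(k in [set k | (n <= k)%N]) A k.
have mB n : measurable (B n) by apply: bigcup_measurable.
have B_anti : {homo B : n m / (n <= m)%N >-> (m <= n)%O}.
  move=> n m nm; apply/subsetPset => w [k /= mk Ak].
  by exists k => //=; exact: leq_trans mk.
have mIB : measurable (\bigcap_n B n) by exact: bigcapT_measurable.
have IB0 : P (\bigcap_n B n) = 0.
  apply/eqP; rewrite eq_le measure_ge0 andbT -N0 le_measure ?inE//.
  (* A point of every [B n] has increments of size at least [e] at arbitrarily late times, so [Y]
     cannot converge there. *)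
  move=> w wB; apply: YN => /= Yw.
  have D0 : (Y n.+1 w - Y n w)%R @[n --> \oo] --> (0%R : R).
    rewrite -[X in _ --> X](subrr (limn (Y^~ w))).
    by apply: cvgB => //; rewrite (cvg_shiftS (Y^~ w)).
  have [n _ nD] := cvgr0_norm_lt _ D0 _ e0.
  have [k /= nk] := wB n I.
  by rewrite /A/= leNgt nD.
apply: (subset_cvg0 _ mB) => // [n w Aw|].
  by exists n => //=.
rewrite -IB0; apply: nonincreasing_cvg_mu => //.
by rewrite (le_lt_trans (probability_le1 _ _))// ltry.
Qed.

End convergence_to_zero_in_probability.

(** * Countability of the group and of its words *)

Lemma countable_tuple (T : choiceType) (n : nat) :
  countable [set: T] -> countable [set: n.-tuple T].
Proof.
move=> /countable_injP[g g_inj].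
apply/countable_injP; exists (fun w : n.-tuple T => choice.pickle (map g w)).
move=> w1 w2 _ _ /(pcan_inj choice.pickleK) /inj_map w12.
by apply/val_inj/w12 => x y; apply: g_inj; rewrite inE.
Qed.

(** The products of words in [S] form a subgroup, with inverses because [S] is symmetric, and there
    are countably many words. *)
Lemma generates_countable (G : groupType) (S : {fset G}) :
  symmetric_set S -> generates S -> countable [set: G].
Proof.
move=> S_sym S_gen.
pose word (w : seq S) := (\prod_(s <- w) val s)%g.
suff -> : [set: G] = range word.
  exact: sub_countable (card_image_le _ _) (countableP _).
rewrite -(S_gen (range word))//; last first.
  move=> s /= sS; exists [:: [` sS]%fset] => //.
  by rewrite /word big_seq1.
have word_inv w : exists w', word w' = (word w)^-1%g.
  elim: w => [|s w [w' w'E]]; first by exists [::]; rewrite /word big_nil invg1.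
  exists (rcons w' [` S_sym _ (valP s)]%fset).
  rewrite /word big_rcons big_cons/= -[X in (X * _)%g = _]/(word w') w'E.
  by rewrite [RHS]invgM.
split; first by rewrite inE; exists [::] => //; rewrite /word big_nil.
move=> _ _ /set_mem[v _ <-] /set_mem[w _ <-].
have [w' w'E] := word_inv w.
by rewrite inE; exists (v ++ w') => //; rewrite /word big_cat -w'E.
Qed.

(** * Maps into a countable set *)

Section countable_image.
Context (R : realType) (d : measure_display) (Omega : measurableType d).
Context (I : choiceType) (Y : Omega -> I).
Hypothesis I_countable : countable [set: I].
Hypothesis mY : forall i, measurable (Y @^-1` [set i]).

Lemma measurable_preimage_countable (B : set I) : measurable (Y @^-1` B).
Proof.
rewrite [X in measurable X](_ : _ =
    \bigcup_i if i \in B then Y @^-1` [set i] else set0).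
  by apply: countable_bigcupT_measurable => // i; case: ifP.
apply/seteqP; split=> [w BYw|w [i _]] /=; first by exists (Y w); rewrite ?mem_set.
by case: ifPn => // /set_mem Bi Yi; rewrite /preimage/= Yi.
Qed.

Lemma measure_preimage_countable (nu : {measure set Omega -> \bar R})
    (B : set I) :
  nu (Y @^-1` B) = \esum_(i in B) nu (Y @^-1` [set i]).
Proof.
have /countable_injP[g g_inj] := I_countable.
have gE i j : g i = g j -> i = j by apply: g_inj; rewrite inE.
(* The fibres of [Y], indexed by natural numbers through the injection [g], so that countable
   additivity applies. *)
pose F n := Y @^-1` (g @^-1` [set n]).
have FE i : F (g i) = Y @^-1` [set i].
  by apply/seteqP; split => w /=; [exact: gE|move=> <-].
have -> : Y @^-1` B = \bigcup_(n in g @` B) F n.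
  apply/seteqP; split=> [w BYw|w [_ [i Bi <-]]] /=.
    by exists (g (Y w)) => //; exists (Y w).
  by move/gE => ->.
rewrite measure_bigcup; last 2 first.
- by move=> _ [i _ <-]; rewrite FE.
- by move=> m n _ _ [w [/= <- <-]].
rewrite nneseries_esum//.
rewrite (@reindex_esum _ _ _ B _ g).
  by apply: eq_esum => i _; rewrite FE.
split=> [i Bi|i j _ _ /gE//|n /= /set_mem//].
by rewrite /= inE; exists i.
Qed.

End countable_image.

(** * Law of the random walk *)

Section random_walk_law.
Context (R : realType) (G : groupType) (d : measure_display).
Context (Omega : measurableType d) (P : probability Omega R).
Context (mu : probability (discrete G) R) (U : nat -> {RV P >-> discrete G}).
Hypothesis G_countable : countable [set: G].
Hypothesis U_iid : iid mu U.
Local Open Scope ereal_scope.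

Let word t (w : Omega) : t.-tuple G := [tuple (U i w : G) | i < t].
Let eval t (w : t.-tuple G) : G := (\prod_(s <- w) s)%g.

Let walkE t : walk U t = @eval t \o word t.
Proof.
apply/funext => w; rewrite /walk /= /eval big_tuple.
by apply: eq_bigr => i _; rewrite tnth_mktuple.
Qed.

Let wordE t (v : t.-tuple G) : word t @^-1` [set v] =
  \bigcap_(j in [set` [fset j in iota 0 t]%fset])
    (U j @^-1` [set (nth 1%g v j : discrete G)]).
Proof.
apply/seteqP; split=> w /=.
  move=> <- j /=; rewrite !inE mem_iota add0n => /= jt.
  have := tnth_mktuple (fun i : 'I_t => U i w : G) (Ordinal jt).
  by rewrite (tnth_nth 1%g).
move=> wv; apply/eq_from_tnth => i; rewrite tnth_mktuple (tnth_nth 1%g).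
by apply: wv; rewrite /= !inE mem_iota add0n/=.
Qed.

Let mU t (A : set G) : measurable (U t @^-1` A).
Proof. by rewrite -[X in measurable X]setTI; exact: measurable_funP. Qed.

Let mword t v : measurable (word t @^-1` [set v]).
Proof.
by rewrite wordE; apply: fin_bigcap_measurable => // j _; exact: mU.
Qed.

Let word_law t v : P (word t @^-1` [set v]) = \prod_(s <- v) mu [set s].
Proof.
have [U_ind U_law] := U_iid.
rewrite wordE U_ind// (perm_big (iota 0 t)); last first.
  apply: uniq_perm; rewrite ?fset_uniq ?iota_uniq// => j.
  by rewrite !inE.
rewrite (big_nth 1%g) size_tuple /index_iota subn0.
by apply: eq_bigr => j _; exact: U_law.
Qed.

Lemma measurable_walk_preimage t (A : set G) : measurable (walk U t @^-1` A).
Proof.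
rewrite walkE comp_preimage; apply: measurable_preimage_countable.
  exact: countable_tuple.
exact: mword.
Qed.

(** Stated for any measure, since it is applied to [P], to a restriction of [P] and to a multiple of
    [P]. *)
Let walk_preimage_esum (nu : {measure set Omega -> \bar R}) t (A : set G) :
  nu (walk U t @^-1` A) =
  \esum_(v in @eval t @^-1` A) nu (word t @^-1` [set v]).
Proof.
rewrite walkE comp_preimage; apply: measure_preimage_countable.
  exact: countable_tuple.
exact: mword.
Qed.

Lemma walk_step_independent t (A : set G) (s : G) :
  P (walk U t @^-1` A `&` U t @^-1` [set (s : discrete G)]) =
  mu [set (s : discrete G)] * P (walk U t @^-1` A).
Proof.
have mus : mu [set (s : discrete G)] \is a fin_num by exact: fin_num_measure.
(* Both sides are values of a measure at the same event: [P] restricted to [U t = s], and [P] scaled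
   by the mass of [s]. They are compared word by word. *)
rewrite -[LHS]/(mrestr P (mU t [set s]) _).
pose r := NngNum (fine_ge0 (measure_ge0 mu [set (s : discrete G)])).
have rE : r%:num%:E = mu [set (s : discrete G)] by rewrite /r/= fineK.
rewrite -rE -[RHS]/(mscale r P _) !walk_preimage_esum.
apply: eq_esum => v _; rewrite -[RHS]/(r%:num%:E * P (word t @^-1` [set v])).
rewrite -[LHS]/(P (word t @^-1` [set v] `&` U t @^-1` [set (s : discrete G)])).
rewrite rE word_law.
rewrite [X in P X](_ : _ = word t.+1 @^-1` [set [tuple of rcons v s]]).
  by rewrite word_law /= big_rcons/= muleC.
apply/seteqP; split => w /=.
- move=> [<- <-]; apply: eq_from_tnth => i; rewrite tnth_mktuple.
  rewrite (tnth_nth 1%g) /= nth_rcons size_map size_enum_ord.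
  have [it|ti|it] := ltngtP i t.
  + have := tnth_mktuple (fun i : 'I_t => U i w : G) (Ordinal it).
    by rewrite (tnth_nth 1%g).
  + by have := ltn_ord i; rewrite ltnS leqNgt ti.
  + by rewrite it.
- move=> wv; split.
  + apply: eq_from_tnth => i; rewrite tnth_mktuple.
    have := congr1 (fun u => tnth u (widen_ord (leqnSn t) i)) wv.
    rewrite tnth_mktuple /= !(tnth_nth 1%g) /= nth_rcons size_tuple ltn_ord.
    by [].
  + have := congr1 (fun u => tnth u ord_max) wv.
    by rewrite tnth_mktuple /= (tnth_nth 1%g) /= nth_rcons size_tuple ltnn eqxx.
Qed.

Hypothesis mu_sym : symmetric_measure mu.

(** Reversing a word and inverting its letters inverts its product and, by symmetry of [mu], keeps
    its probability. *)
Lemma walk_law_inv t (A : set G) :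
  P (walk U t @^-1` [set g | A g^-1%g]) = P (walk U t @^-1` A).
Proof.
rewrite !walk_preimage_esum.
pose e (v : t.-tuple G) : t.-tuple G := [tuple of rev [seq g^-1%g | g <- v]].
have eK : involutive e.
  move=> v; apply: val_inj; rewrite /= map_rev revK -map_comp.
  by rewrite map_id_in// => g _ /=; rewrite invgK.
have evalV v : eval (e v) = (eval v)^-1%g.
  by rewrite /eval /= -map_rev big_map prodgV revK.
rewrite [RHS](@reindex_esum _ _ _ [set v | A (eval v)^-1%g] _ e); last first.
  split=> [v Av|v1 v2 _ _ /(inv_inj eK)//|v Av]; first by rewrite /= evalV.
  by exists (e v); rewrite ?eK//= evalV invgK.
apply: eq_esum => v _.
rewrite -[LHS]/(P (word t @^-1` [set v])).
rewrite -[RHS]/(P (word t @^-1` [set e v])).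
rewrite !word_law /= [RHS](perm_big [seq g^-1%g | g <- v]).
  by rewrite big_map; apply: eq_bigr => g _; exact: mu_sym.
by rewrite perm_rev.
Qed.

End random_walk_law.

(** * Convergence along the walk *)

Section walk_convergence.
Context (R : realType) (G : groupType) (d : measure_display).
Context (Omega : measurableType d) (P : probability Omega R).
Context (mu : probability (discrete G) R) (U : nat -> {RV P >-> discrete G}).
Hypothesis G_countable : countable [set: G].
Hypothesis U_iid : iid mu U.

Lemma measurable_fun_walk t (phi : G -> R) :
  measurable_fun setT (fun w => phi (walk U t w)).
Proof.
move=> _ A mA; rewrite setTI.
exact: (measurable_walk_preimage U G_countable t (phi @^-1` A)).
Qed.

(** The event [A t] is independent of [U t = s], so its probability is that of [B t] divided by the
    positive mass of [s]; on [B t] the argument [s] is the actual step. *)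
Lemma cvg0_in_probability_step (psi : G -> G -> R) (s : G) :
  (0 < mu [set (s : discrete G)])%E ->
  cvg0_in_probability P (fun t w => psi (walk U t w) (U t w)) ->
  cvg0_in_probability P (fun t w => psi (walk U t w) s).
Proof.
move=> s0 [mpsi psi0].
have mpsis t := measurable_fun_walk t (psi^~ s).
split=> // e e0.
have mus : mu [set (s : discrete G)] \is a fin_num by exact: fin_num_measure.
pose A t := walk U t @^-1` [set g | e <= `|psi g s|].
pose B t := A t `&` U t @^-1` [set (s : discrete G)].
have mA t : measurable (A t).
  exact: measurable_walk_preimage.
have mB t : measurable (B t).
  apply: measurableI => //.
  by rewrite -[X in measurable X]setTI; exact: measurable_funP.
have B0 : P (B t) @[t --> \oo] --> 0%E.
  apply: (subset_cvg0 mB _ _ (psi0 e e0)) => t.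
    exact: measurable_norm_ge.
  by move=> w [/= eA ->].
have AE t : P (A t) = ((fine (mu [set (s : discrete G)]))^-1%:E * P (B t))%E.
  rewrite /B (walk_step_independent G_countable U_iid) muleA -{2}(fineK mus) -EFinM mulVf ?mul1e//.
  by rewrite gt_eqF// fine_gt0// s0 ltey_eq mus.
have mus_fin : ((fine (mu [set (s : discrete G)]))^-1)%:E \is a fin_num by [].
have := cvgeZl mus_fin B0.
by rewrite mule0; under eq_fun do rewrite -AE.
Qed.

Lemma cvg0_in_probability_shift (Y : nat -> Omega -> R) :
  cvg0_in_probability P Y -> cvg0_in_probability P (fun t => Y t.+1).
Proof.
move=> [mY Y0]; split=> // e /Y0.
by rewrite -(cvg_shiftS (fun t => P [set w | e <= `|Y t w|])).
Qed.

Hypothesis mu_sym : symmetric_measure mu.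

Lemma cvg0_in_probability_inv (phi : G -> R) :
  cvg0_in_probability P (fun t w => phi (walk U t w)) ->
  cvg0_in_probability P (fun t w => phi (walk U t w)^-1%g).
Proof.
move=> [_ phi0]; split=> [t|e /phi0].
  exact: (measurable_fun_walk t (fun g => phi g^-1%g)).
suff -> : (fun t => P [set w | e <= `|phi (walk U t w)|]) =
  (fun t => P [set w | e <= `|phi (walk U t w)^-1%g|]) by [].
apply/funext => t; apply: esym.
exact: (walk_law_inv G_countable U_iid mu_sym t [set g | e <= `|phi g|]).
Qed.

Hypothesis mu_adapted : adapted mu.

(* The atoms [s] of [mu] satisfy [good k -> good (s * k)], and the group of the
   elements that preserve goodness together with their inverses has full
   measure. *)
Lemma walk_right_translation_cvg0 (f : G -> R) :
  converges_along_walks U f ->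
  forall x g, cvg0_in_probability P
    (fun t w => f (x * walk U t w * g)%g - f (x * walk U t w)%g).
Proof.
move=> f_cvg.
pose good g := forall x, cvg0_in_probability P
    (fun t w => f (x * walk U t w * g)%g - f (x * walk U t w)%g).
have good1 : good 1%g.
  move=> x; under eq_fun do under eq_fun do rewrite mulg1 subrr.
  exact: cvg0_in_probability0.
have walkS t w : walk U t.+1 w = (walk U t w * U t w)%g.
  by rewrite /walk big_ord_recr.
have good_atom s : (0 < mu [set (s : discrete G)])%E -> good s.
  move=> s0 x.
  apply: (cvg0_in_probability_step
    (psi := fun h u => f (x * h * u)%g - f (x * h)%g)) => //.
  under eq_fun do under eq_fun do rewrite -mulgA -walkS.
  apply: (ae_cvg_increments (Y := fun t w => f (x * walk U t w)%g)) => // t.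
  exact: (measurable_fun_walk t (fun h => f (x * h)%g)).
have goodM s g : (0 < mu [set (s : discrete G)])%E -> good g -> good (s * g)%g.
  move=> s0 gg x.
  (* Goodness of [g] at time [t.+1], where the walk is [walk U t * U t], conditioned on
     [U t = s]. *)
  have step : cvg0_in_probability P (fun t w =>
      f (x * walk U t w * s * g)%g - f (x * walk U t w * s)%g).
    apply: (cvg0_in_probability_step
      (psi := fun h u => f (x * h * u * g)%g - f (x * h * u)%g)) => //.
    have := cvg0_in_probability_shift (gg x).
    by under eq_fun do under eq_fun do rewrite walkS mulgA.
  have := cvg0_in_probability_lin 1 step (good_atom s s0 x).
  congr cvg0_in_probability; apply/funext => t; apply/funext => w.
  by rewrite mul1r addrA subrK mulgA.
pose H := [set g | forall k, good k -> good (g * k)%g /\ good (g^-1 * k)%g].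
have H_group : group_closed [in H].
  split; first by rewrite inE => k gk; rewrite invg1 mul1g.
  move=> g h /set_mem Hg /set_mem Hh; rewrite inE => k gk.
  by split; rewrite ?invgF -mulgA; [apply Hg, Hh|apply Hh, Hg].
have H_atom s : (0 < mu [set (s : discrete G)])%E -> H s.
  by move=> s0 k gk; split; apply: goodM => //; rewrite -mu_sym.
have HT : H = [set: G].
  apply: mu_adapted => //.
  (* No point outside [H] is an atom, and [G] is countable. *)
  have HC0 : mu (~` (H : set (discrete G))) = 0%E.
    rewrite -[~` _](preimage_id) (measure_preimage_countable (Y := id))//.
    apply: esum1 => s nHs; apply/eqP; apply: contrapT => /negP.
    by rewrite neq_lt ltNge measure_ge0/= => /H_atom.
  by rewrite -[H]setCK [LHS](probability_setC mu)// HC0 sube0.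
move=> x g; rewrite -[g]mulg1.
have [+ _] : good (g * 1)%g /\ good (g^-1 * 1)%g.
  by have /(_ _ good1) : H g by rewrite HT.
by [].
Qed.

End walk_convergence.

(** * Finite-dimensional orbits *)

Lemma lin_span_range (R : realType) (V : lmodType R) (n : nat) (b : 'I_n -> V)
    (v : V) :
  lin_span (range b) v -> exists c : 'I_n -> R, v = \sum_i c i *: b i.
Proof.
move=> [m [a [u [ub ->]]]].
have /choice[j jE] i : exists j, b j = u i by have [j _ <-] := ub i; exists j.
(* The family [u] may repeat a vector [b k]; the coefficients of its copies are added up. *)
exists (fun k => \sum_(i | j i == k) a i).
under [RHS]eq_bigr do rewrite scaler_suml.
rewrite (partition_big j xpredT)//=; apply: eq_bigr => k _.
by apply: eq_bigr => i /eqP <-; rewrite jE.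
Qed.

(** [f (x * y)] is the value at [y] of the translate of [f] by [x^-1]; the [a i x] are coefficients
    of this translate in the spanning family [b]. *)
Lemma finite_dimensional_orbit_kernel (R : realType) (G : groupType)
    (f : G -> R) :
  finite_dimensional (lin_span (fun_orbit f)) ->
  exists n (a b : 'I_n -> G -> R),
    forall x y, f (x * y)%g = \sum_i a i x * b i y.
Proof.
move=> [n [b spanE]].
have /choice[a aE] x : exists c : 'I_n -> R,
    translate x^-1%g f = \sum_i c i *: b i.
  apply: lin_span_range; rewrite -spanE.
  exists 1%N, (fun=> 1), (fun=> translate x^-1%g f); split=> [_|].
    by exists x^-1%g.
  by rewrite big_ord1 scale1r.
exists n, (fun i x => a x i), b => x y.
have := congr1 (fun g => g y) (aE x); rewrite /translate invgK => ->.
by rewrite fct_sumE.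
Qed.

(** * Vanishing of the differences of [f] *)

Theorem mainTheorem7 (R : realType) (G : groupType) (S : {fset G})
    (S_sym : symmetric_set S) (S_gen : generates S)
    (G_amenable : amenable R G)
    (mu : probability (discrete G) R) (mu_courteous : courteous S mu)
    (d : measure_display) (Omega : measurableType d) (P : probability Omega R)
    (U : nat -> {RV P >-> discrete G}) (U_iid : iid mu U)
    (f : G -> R) (f_cvg : converges_along_walks U f)
    (f_fin : finite_dimensional (lin_span (fun_orbit f))) :
  exists c : R, forall x : G, f x = c.
Proof.
have [mu_adapted mu_sym _] := mu_courteous.
have G_countable := generates_countable S_sym S_gen.
have f0 := walk_right_translation_cvg0 G_countable U_iid mu_sym mu_adapted f_cvg.
suff fM x y : f (x * y)%g - f x = 0.
  by exists (f 1%g) => y; rewrite -[y in LHS]mul1g -[LHS](subrK (f 1%g)) fM add0r.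
have [n [a [b fE]]] := finite_dimensional_orbit_kernel f_fin.
(* For the fixed [x] and [y], [A] and [B] are the conditions wanted of the left and right
   factors. *)
pose A := [set u : G -> R |
  cvg0_in_probability P (fun t w => u (x * walk U t w)%g)].
pose B := [set v : G -> R | cvg0_in_probability P
  (fun t w => v ((walk U t w)^-1 * y)%g - v (walk U t w)^-1%g)].
have [||z|z|z g|m [u [v [Au Bv uvE]]]] := @finite_rank_kernel_decomposition
    _ _ _ A B _ _ n (fun z g => f (z * g)%g - f z) a
    (fun i g => b i g - b i 1%g).
- by move=> c u v Au Av; exact: cvg0_in_probability_lin.
- move=> c u v Bu Bv; have := cvg0_in_probability_lin c Bu Bv.
  congr cvg0_in_probability; apply/funext => t; apply/funext => w; ring.
- by rewrite /A/=; exact: f0.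
(* In the difference of two values of the row at [z] the term [f z] cancels, leaving a right
   translation by [y] along the inverted walk. *)
- have := cvg0_in_probability_inv G_countable U_iid mu_sym
    (phi := fun g => f (z * g * y)%g - f (z * g)%g) (f0 z y).
  congr cvg0_in_probability; apply/funext => t; apply/funext => w.
  by rewrite mulgA; ring.
(* Writing [f z] as [f (z * 1)] gives the right factors [b i g - b i 1]. *)
- rewrite -{2}[z]mulg1 !fE -sumrB; apply: eq_bigr => i _; ring.
apply: (@cvg0_in_probability_cst _ _ _ P).
have := cvg0_in_probability_sum (fun i => cvg0_in_probabilityM (Au i) (Bv i)).
congr cvg0_in_probability; apply/funext => t; apply/funext => w.
set h := walk U t w.
under eq_bigr do rewrite mulrBr.
(* The sums are the kernel at [(x * h, h^-1 * y)] and at [(x * h, h^-1)]; in their difference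
   [f (x * h)] cancels. *)
rewrite sumrB -!uvE /cst !mulgA mulgK.
ring.
Qed.
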